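(* Let $\{G_i:i\in I\}$ be a family of compact Hausdorff groups and let $G=\prod_{i\in I}G_i$ carry the Tychonoff product topology. Then a closed subgroup $H$ of $G$ is controllable in $G$ if and only if $H$ is uniformly controllable in $G$.
   Context: For a family of groups $\{G_i:i\in I\}$ with direct product $G=\prod_{i\in I}G_i$ and $K\subseteq I$, $\bigoplus_{i\in K}G_i$ denotes the subgroup of $G$ consisting of all $g\in G$ such that $g(i)$ is the identity of $G_i$ for all but finitely many $i\in I$ and for every $i\in I\setminus K$. For $J\subseteq I$, $p_{IJ}:\prod_{i\in I}G_i\to\prod_{j\in J}G_j$ is the projection (restriction) $g\mapsto g\restriction_J$. A subgroup $H$ of $G$ is: controllable in $G$ if $p_{IJ}(H)=p_{IJ}(H\cap\bigoplus_{i\in I}G_i)$ for every finite set $J\subseteq I$; uniformly controllable in $G$ if for every finite set $J\subseteq I$ there exists a finite set $K\subseteq I$ such that $p_{IJ}(H)=p_{IJ}(H\cap\bigoplus_{i\in K}G_i)$. *)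

(* Defs.v *)
From HB Require Import structures.
From mathcomp Require Import all_boot all_algebra all_classical.
From mathcomp Require Import topology.

Set Implicit Arguments.
Unset Strict Implicit.
Unset Printing Implicit Defensive.

Local Open Scope classical_set_scope.
Local Open Scope group_scope.

HB.structure Definition PreTopologicalGroup := {G of Topological G & Group G}.

HB.mixin Record PreTopologicalGroup_isTopologicalGroup G
    & PreTopologicalGroup G := {
  mulg_continuous : continuous (fun x : G * G => x.1 * x.2) ;
  invg_continuous : continuous (fun x : G => x^-1) ;
}.

(* No separation axiom is built in. *)
#[short(type="topologicalGroupType")]
HB.structure Definition TopologicalGroup :=
  {G of PreTopologicalGroup G & PreTopologicalGroup_isTopologicalGroup G}.

Section ProductGroup.
Context {I : Type} (G : I -> groupType).
Implicit Types f g h : prod_topology G.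

Let one : prod_topology G := fun=> 1.
Let inv f : prod_topology G := fun i => (f i)^-1.
Let mul f g : prod_topology G := fun i => f i * g i.

Let mulA : associative mul.
Proof. by move=> f g h; apply/functional_extensionality_dep => i; exact: mulgA. Qed.

Let mul1 : left_id one mul.
Proof. by move=> f; apply/functional_extensionality_dep => i; exact: mul1g. Qed.

Let mulr1 : right_id one mul.
Proof. by move=> f; apply/functional_extensionality_dep => i; exact: mulg1. Qed.

Let mulV : left_inverse one inv mul.
Proof. by move=> f; apply/functional_extensionality_dep => i; exact: mulVg. Qed.

Let mulrV : right_inverse one inv mul.
Proof. by move=> f; apply/functional_extensionality_dep => i; exact: mulgV. Qed.

HB.instance Definition _ :=
  isGroup.Build (prod_topology G) mulA mul1 mulr1 mulV mulrV.

End ProductGroup.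

Lemma prod1gE (I : Type) (G : I -> groupType) i : (1 : prod_topology G) i = 1.
Proof. by []. Qed.

Lemma prodMgE (I : Type) (G : I -> groupType) (f g : prod_topology G) i :
  (f * g) i = f i * g i.
Proof. by []. Qed.

Lemma prodVgE (I : Type) (G : I -> groupType) (f : prod_topology G) i :
  f^-1 i = (f i)^-1.
Proof. by []. Qed.

Section ProductTopologicalGroup.
Context {I : Type} (G : I -> topologicalGroupType).

Let proj_cvg (f : prod_topology G) i : h i @[h --> f] --> f i.
Proof.
have /cvg_sup/(_ i) fi : nbhs f --> f by exact: cvg_id.
move=> A; rewrite nbhsE => -[B [oB Bfi] BA]; apply: (fi [set h | A (h i)]).
by exists [set h : prod_topology G | B (h i)]; split=> [|//|h /= /BA //]; exists B.
Qed.

Let cvg_prod (T : Type) (F : set_system T) (FF : Filter F)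
    (h : T -> prod_topology G) (f : prod_topology G) :
  (forall i, h x i @[x --> F] --> f i) -> h @ F --> f.
Proof.
move=> hf; apply/cvg_sup => i A [_ [[B oB <-] Bfi] BA].
have nB : nbhs (f i) B by rewrite nbhsE; exists B.
by apply: (@filterS _ F FF _ _ _ (hf i B nB)) => x; exact: BA.
Qed.

Let mul_cts :
  continuous (fun x : prod_topology G * prod_topology G => x.1 * x.2).
Proof.
move=> -[f g]; apply: cvg_prod => i.
pose p (h : prod_topology G) : G i := h i.
apply: (@continuous_comp _ _ _
  (fun x : prod_topology G * prod_topology G => (p x.1, p x.2))
  (fun x : G i * G i => x.1 * x.2) (f, g)).
  apply: cvg_pair.
    by apply: (@continuous_comp _ _ _ fst p (f, g)); [exact: cvg_fst|exact: proj_cvg].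
  by apply: (@continuous_comp _ _ _ snd p (f, g)); [exact: cvg_snd|exact: proj_cvg].
exact: mulg_continuous.
Qed.

Let inv_cts : continuous (fun f : prod_topology G => f^-1).
Proof.
move=> f; apply: (@cvg_prod _ _ (nbhs_filter f)) => i.
pose p (h : prod_topology G) : G i := h i.
by apply: (@continuous_comp _ _ _ p (fun x : G i => x^-1) f);
  [exact: proj_cvg|exact: invg_continuous].
Qed.

HB.instance Definition _ :=
  PreTopologicalGroup_isTopologicalGroup.Build (prod_topology G) mul_cts inv_cts.

End ProductTopologicalGroup.

(* The projection p_IJ, where the product over J is indexed by the subtype of
   I defined by J. *)
Definition restr {I : Type} {T : I -> Type} (J : set I) (g : prod_topology T) :
    prod_topology (fun j : J => T (val j)) :=
  fun j => g (val j).
Arguments restr {I T} J g.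

Definition subgroup (T : groupType) (H : set T) : Prop := group_closed [in H].

Section Controllability.
Context {I : Type} (G : I -> groupType).

Definition direct_sum (K : set I) : set (prod_topology G) :=
  [set g | finite_set [set i | g i <> 1] /\ forall i, ~ K i -> g i = 1].

Definition controllable (H : set (prod_topology G)) : Prop :=
  forall J : set I, finite_set J ->
    restr J @` H = restr J @` (H `&` direct_sum [set: I]).

Definition uniformly_controllable (H : set (prod_topology G)) : Prop :=
  forall J : set I, finite_set J ->
    exists2 K : set I, finite_set K &
      restr J @` H = restr J @` (H `&` direct_sum K).

End Controllability.

(* Main.v *)
Require Import Defs.
From HB Require Import structures.
From mathcomp Require Import all_boot all_algebra all_classical.
From mathcomp Require Import topology.

Set Implicit Arguments.
Unset Strict Implicit.
Unset Printing Implicit Defensive.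

(** Fix a finite J and let p be the projection to the coordinates in J.  For
    K finite let E_K be the set of the h with p h in p(H ∩ ⊕_K).  If H is
    controllable, the E_K with K finite cover H, and uniform controllability
    asks that a single one of them contain H.  As the cover is directed but
    in general uncountable, and the E_K are closed rather than open,
    compactness of H and the Baire theorem do not apply to it directly; a
    directed family of proper closed subgroups may well cover a compact group.

    The number of nontrivial coordinates gives a countable cover instead.  Let
    B_k be the set of h whose projection p h is p g for some g in H with fewer
    than k nontrivial coordinates.  Having at least k nontrivial coordinates is
    an open condition, so B_k is closed by compactness ([closed_saturation]).
    The B_k cover H, and the Baire theorem [compact_baire] gives a least
    k + 1 such that B_(k+1) contains a nonempty relatively open set U ∩ H.
    By minimality some x in U ∩ H is outside B_k.  Thus every g in H over p x
    with at most k nontrivial coordinates has exactly k of them.  Having k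
    nontrivial coordinates within a set K persists on a neighbourhood of g, so
    the compact set of these g admits one finite K that works for all of them;
    as p is a closed map, this K still works over the projections of all points
    of H near x.  There at most k nontrivial coordinates overall and k of them
    in K force the support into K, so E_K contains a nonempty relatively open
    subset of H ([reached_nbhs]).

    Finally, finitely many translates of this open subset cover H, and each
    translating element lies in some E_K' because H is controllable; enlarging
    K by these K' puts H inside E_K ([reached_uniformly]). *)

Local Open Scope classical_set_scope.

(** * Compactness and category *)

(** A finite subcover of a directed cover reduces to one of its members.  The
    index sets are filtered by inclusion of ever larger finite sets, so that
    the claim becomes the near-covering form of compactness. *)
Lemma compact_directed_cover (T : topologicalType) (I : Type) (A : set T)
    (W : set I -> set T) :
  compact A -> (forall K, open (W K)) ->
  (forall K K', K `<=` K' -> W K `<=` W K') ->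
  (forall x, A x -> exists2 K, finite_set K & W K x) ->
  exists2 K, finite_set K & A `<=` W K.
Proof.
move=> /compact_near_coveringP cA oW monoW coverA.
pose F : set_system (set I) :=
  filter_from finite_set (fun K => [set K' | K `<=` K']).
have FF : Filter F.
  apply: filter_from_filter; first by exists set0.
  move=> K K' finK finK'; exists (K `|` K'); first by rewrite finite_setU.
  by move=> L /= KL; split=> i Ki; apply: KL; [left|right].
have [K finK AW] : F [set K | A `<=` W K].
  apply: (cA _ F (fun K x => W K x) FF) => x Ax.
  have [K finK WKx] := coverA x Ax.
  exists (W K, [set K' | K `<=` K']).
    by split; [exact: open_nbhs_nbhs (conj (oW K) WKx)|exists K].
  by move=> [y K'] /= [WKy KK']; exact: monoW KK' y WKy.
by exists K => //; exact: AW.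
Qed.

(** The Baire category theorem for a closed subset [A] of a compact Hausdorff
    space, with open sets of [T] standing for the relatively open sets of [A].
    Were every [F n] nowhere dense in [A], regularity would give open sets
    [U n] meeting [A] with [closure (U n.+1)] inside [U n] and off [F n]; the
    complements of these closures would then cover [A], and a single one of
    them would do so by compactness. *)
Lemma compact_baire (T : topologicalType) (A : set T) (F : nat -> set T) :
  hausdorff_space T -> compact [set: T] -> closed A -> A !=set0 ->
  (forall n, closed (F n)) -> A `<=` \bigcup_n F n ->
  exists n U, [/\ open U, U `&` A !=set0 & U `&` A `<=` F n].
Proof.
move=> hT cT clA A0 clF AF; apply: contrapT => noU.
have /choice[shrink shrinkP] : forall nU : nat * set T, exists V : set T,
    open nU.2 -> nU.2 `&` A !=set0 ->
    [/\ open V, V `&` A !=set0 & closure V `<=` nU.2 `&` ~` F nU.1].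
  move=> [n U] /=; have [[oU UA]|nUA] := pselect (open U /\ U `&` A !=set0);
    last by exists set0 => oU UA; case: nUA.
  have [x [[Ux Ax] nFx]] : exists x, (U `&` A) x /\ ~ F n x.
    apply: contrapT => nx; apply: noU; exists n, U; split=> // x UAx.
    by apply: contrapT => nFx; apply: nx; exists x.
  have nbhsx : nbhs x (U `&` ~` F n).
    apply: open_nbhs_nbhs; split; last by split.
    by apply: openI => //; exact: closed_openC.
  have [V nV clV] := compact_regular hT cT filterT nbhsx.
  exists V° => _ _; split; first exact: open_interior.
    by exists x.
  by apply: subset_trans clV; apply: closureS; exact: interior_subset.
pose U := fix U n := if n is n'.+1 then shrink (n', U n') else [set: T].
have UP n : open (U n) /\ U n `&` A !=set0.
  elim: n => [|n [oU UA]]; last by have [] := shrinkP (n, U n) oU UA.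
  by split; [exact: openT|rewrite setTI].
have clU n : closure (U n.+1) `<=` U n `&` ~` F n.
  by have [oU UA] := UP n; have [] := shrinkP (n, U n) oU UA.
have decU m n : (m <= n)%N -> U n `<=` U m.
  move=> /subnK <-; elim: (n - m)%N => [//|k IH] x.
  by rewrite addSn => /(@subset_closure _ _ x)/clU[] /IH.
have /compact_near_coveringP cA : compact A.
  exact: subclosed_compact clA cT _.
have [N _ NU] : \forall n \near \oo, A `<=` ~` U n.
  apply: (cA _ _ (fun n x => ~ U n x)) => x Ax.
  have [n _ Fnx] := AF x Ax.
  exists (~` closure (U n.+1), [set m | (n.+1 <= m)%N]).
    split; last by exists n.+1.
    apply: open_nbhs_nbhs; split.
      by apply: closed_openC; exact: closed_closure.
    by move=> /clU[_].
  move=> [y m] /= [nUy nm] /(decU _ _ nm)/(@subset_closure _ _ y).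
  exact: nUy.
have [_ [x [Ux Ax]]] := UP N.
by case: (NU N (leqnn N) x Ax).
Qed.

(** A continuous map from a compact set to a Hausdorff space is closed; this is
    the form of that fact used to pull closed sets back along a projection. *)
Lemma closed_saturation (T L : topologicalType) (p : T -> L) (A : set T) :
  hausdorff_space L -> continuous p -> compact A ->
  closed (p @^-1` (p @` A)).
Proof.
move=> hL ctsp cA; apply: preimage_closed; first by move=> x _; exact: ctsp.
by apply: compact_closed => //; apply: continuous_compact => //;
  exact: continuous_subspaceT.
Qed.

(** * Supports in products of compact groups *)

Lemma mulgl_continuous (T : topologicalGroupType) (z : T) :
  continuous (fun x : T => z * x)%g.
Proof.
move=> x; apply: (@continuous_comp _ _ _ (fun y => (z, y))
  (fun y : T * T => y.1 * y.2)%g); last exact: mulg_continuous.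
by apply: cvg_pair; [exact: cvg_cst|exact: cvg_id].
Qed.

Section Product.
Context {I : Type} (G : I -> topologicalGroupType).
Implicit Types (g h : prod_topology G) (J K : set I).

Lemma coordinate_continuous i :
  continuous (fun g : prod_topology G => g i).
Proof. exact: (@proj_continuous {classic I} G i). Qed.

Lemma restr_continuous J :
  continuous (restr J : prod_topology G -> prod_topology (fun j : J => G (val j))).
Proof.
move=> f; apply/(cvg_sup _ _ (fmap_filter _ (nbhs_filter f))).
move=> j A [_ [[B oB <-] Bfj] BA].
have nB : nbhs (f (val j)) B by rewrite nbhsE; exists B.
apply: (@filterS _ (nbhs f) (nbhs_filter f) _ _ _
  (@coordinate_continuous (val j) f B nB)) => g; exact: BA.
Qed.

Hypothesis compactG : forall i : I, compact [set: G i].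
Hypothesis hausdorffG : forall i : I, hausdorff_space (G i).

Lemma prod_compact : compact [set: prod_topology G].
Proof.
have := @tychonoff {classic I} G (fun=> setT) compactG.
by congr compact; apply/seteqP; split.
Qed.

Lemma prod_hausdorff : hausdorff_space (prod_topology G).
Proof. exact: (@hausdorff_product {classic I} G). Qed.

(** Counting with duplicate-free sequences makes the lower semicontinuity of the
    size of the support immediate: each sequence imposes finitely many open
    conditions. *)
Definition support_ge k (K : set I) : set (prod_topology G) :=
  [set g | exists s : seq {classic I},
     [/\ uniq s, size s = k & forall i, i \in s -> K i /\ g i <> 1%g]].

Lemma open_support_ge k K : open (support_ge k K).
Proof.
have oS (s : seq {classic I}) :
    open [set g : prod_topology G | forall i, i \in s -> g i <> 1%g].
  elim: s => [|i s oS].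
    rewrite (_ : mkset _ = setT); first exact: openT.
    by apply/seteqP; split.
  rewrite (_ : mkset _ = (fun g : prod_topology G => g i) @^-1` (~` [set 1%g])
      `&` [set g | forall i, i \in s -> g i <> 1%g]).
    apply: openI => //; apply: open_comp.
      by move=> g _; exact: coordinate_continuous.
    apply: closed_openC; apply: accessible_closed_set1.
    exact: hausdorff_accessible.
  apply/seteqP; split=> g /=.
    move=> gs; split; first by apply: gs; rewrite mem_head.
    by move=> j js; apply: gs; rewrite in_cons js orbT.
  move=> [gi gs] j; rewrite in_cons => /orP[/eqP->//|]; exact: gs.
rewrite (_ : support_ge k K = \bigcup_(s in [set s : seq {classic I} |
    [/\ uniq s, size s = k & forall i, i \in s -> K i]])
  [set g | forall i, i \in s -> g i <> 1%g]).
  by apply: bigcup_open => s _; exact: oS.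
apply/seteqP; split=> g.
  move=> [s [us sk sg]]; exists s => /=.
    by split=> // i /sg[].
  by move=> i /sg[].
by move=> [s [us sk sK] sg]; exists s; split=> // i si; split; [exact: sK|exact: sg].
Qed.

Lemma finite_support_lt {g} : finite_set [set i | g i <> 1%g] ->
  exists k, ~ support_ge k setT g.
Proof.
move=> /(@finite_seqP {classic I})[t tE]; exists (size t).+1 => -[s [us sk sg]].
have : (size s <= size t)%N.
  apply: uniq_leq_size => // i /sg[_ gi].
  by have : [set` t] i by rewrite -tE.
by rewrite sk ltnn.
Qed.

(** If [K] already holds [k] nontrivial coordinates and there are at most [k]
    in total, then none is left outside [K]. *)
Lemma support_ge_direct_sum k K g : finite_set K ->
  support_ge k K g -> ~ support_ge k.+1 setT g -> direct_sum K g.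
Proof.
move=> finK [s [us sk sg]] ng.
have gK i : ~ K i -> g i = 1%g.
  move=> nKi; apply: contrapT => gi; apply: ng; exists (i :: s : seq {classic I}).
  split=> /=; [|by rewrite sk|].
    by rewrite us andbT; apply/negP => /sg[].
  by move=> j; rewrite in_cons => /orP[/eqP->//|/sg[]].
split=> //; apply: sub_finite_set finK => i /= gi.
by apply: contrapT => /gK.
Qed.

Lemma direct_sumM K K' g h : direct_sum K g -> direct_sum K' h ->
  direct_sum (K `|` K') (g * h)%g.
Proof.
move=> [fg gK] [fh hK']; split.
  apply: (@sub_finite_set _ _ ([set i | g i <> 1%g] `|` [set i | h i <> 1%g])).
    move=> i /= ghi; apply: contrapT => /not_orP[/contrapT gi /contrapT hi].
    by apply: ghi; rewrite prodMgE gi hi mulg1.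
  by rewrite finite_setU.
by move=> i /not_orP[/gK gi /hK' hi]; rewrite prodMgE gi hi mulg1.
Qed.

Lemma direct_sumS K K' : K `<=` K' -> direct_sum K `<=` @direct_sum I G K'.
Proof. by move=> KK' g [fg gK]; split=> // i nK'i; apply: gK => /KK'. Qed.

(** * Controllable closed subgroups *)

Variables (H : set (prod_topology G)) (J : set I).
Hypothesis subgroupH : subgroup H.
Hypothesis closedH : closed H.

Local Notation p := (restr J : prod_topology G -> _).

Let H1 : H 1%g.
Proof. by have [/set_mem] := subgroupH. Qed.

Let HV g h : H g -> H h -> H (g * h^-1)%g.
Proof.
by have [_ H_] := subgroupH; move=> Hg Hh; apply/set_mem/H_; exact/mem_set.
Qed.

Let HM g h : H g -> H h -> H (g * h)%g.
Proof.
move=> Hg Hh; rewrite -(invgK h); apply: HV => //.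
by rewrite -(mul1g h^-1%g); exact: HV.
Qed.

Let compactI A : closed A -> compact (H `&` A).
Proof.
by move=> clA; apply: subclosed_compact prod_compact _ => //; exact: closedI.
Qed.

Let closed_lt k : closed (~` support_ge k setT).
Proof. by apply: open_closedC; exact: open_support_ge. Qed.

Let hausdorffJ : hausdorff_space (prod_topology (fun j : J => G (val j))).
Proof. exact: (@hausdorff_product {classic J} (fun j : J => G (val j))). Qed.

Definition reached K : set (prod_topology G) :=
  [set h | (p @` (H `&` direct_sum K)) (p h)].

(** The least [k] for which the Baire theorem applies makes the minimal size of
    a support constant near [x]; minimal supports cannot shrink in the limit,
    so over points near [x] they stay within finitely many coordinates. *)
Lemma reached_nbhs :
  H `<=` \bigcup_(K in finite_set) reached K ->
  exists K U, [/\ finite_set K, open U, U `&` H !=set0 & U `&` H `<=` reached K].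
Proof.
move=> Hreached.
pose B k := p @^-1` (p @` (H `&` ~` support_ge k setT)).
have clB k : closed (B k).
  by apply: closed_saturation => //; [exact: restr_continuous|exact: compactI].
have HB : H `<=` \bigcup_k B k.
  move=> h /Hreached[K finK [g [Hg [fg _]] pg]].
  by have [k ng] := finite_support_lt fg; exists k => //; exists g.
have exk : exists k, `[< exists U,
    [/\ open U, U `&` H !=set0 & U `&` H `<=` B k] >].
  have [k [U UP]] := compact_baire prod_hausdorff prod_compact closedH
    (ex_intro _ _ H1) clB HB.
  by exists k; apply/asboolP; exists U.
case: (ex_minnP exk) => -[|k] /asboolP[U [oU [x0 [Ux0 Hx0]] UB]] mink.
  (* Every support has at least 0 elements, so B 0 is empty. *)
  have [g [_ ng] _] := UB x0 (conj Ux0 Hx0).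
  by case: ng; exists [::].
have [x [[Ux Hx] nBx]] : exists x, (U `&` H) x /\ ~ B k x.
  apply: contrapT => nx; suff : (k.+1 <= k)%N by rewrite ltnn.
  apply: mink; apply/asboolP; exists U; split=> //; first by exists x0.
  by move=> x UHx; apply: contrapT => nBx; apply: nx; exists x.
have cfiber : compact (H `&` (~` support_ge k.+1 setT `&` p @^-1` [set p x])).
  apply: compactI; apply: closedI => //.
  apply: preimage_closed; first by move=> g _; exact: restr_continuous.
  by apply: accessible_closed_set1; exact: hausdorff_accessible.
have [K finK fiberK] : exists2 K, finite_set K &
    H `&` (~` support_ge k.+1 setT `&` p @^-1` [set p x]) `<=` support_ge k K.
  apply: compact_directed_cover cfiber _ _ _.
  - by move=> K; exact: open_support_ge.
  - by move=> K K' KK' g [s [us sk sg]]; exists s; split=> // i /sg[/KK'].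
  move=> g [Hg [_ pg]].
  have [s [us sk sg]] : support_ge k setT g.
    by apply: contrapT => ng; apply: nBx; exists g.
  exists [set` s]; first exact: (@finite_seq {classic I}).
  by exists s; split=> // i si; split=> //; have [] := sg i si.
(* C consists of the points over which some element of H has at most k
   nontrivial coordinates but not k of them in K; x is not among them. *)
pose C := p @^-1` (p @` (H `&` (~` support_ge k.+1 setT `&` ~` support_ge k K))).
have clC : closed C.
  apply: closed_saturation => //; first exact: restr_continuous.
  apply: compactI; apply: closedI => //.
  by apply: open_closedC; exact: open_support_ge.
exists K, (U `&` ~` C); split=> //.
- by apply: openI => //; exact: closed_openC.
- exists x; split=> //; split=> // -[g [Hg [ng ngK]] pg].
  by apply: ngK; apply: fiberK.
move=> h [[Uh nCh] Hh]; have [g [Hg ng] pg] := UB h (conj Uh Hh).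
exists g => //; split=> //; apply: support_ge_direct_sum (ng) => //.
by apply: contrapT => ngK; apply: nCh; exists g.
Qed.

(** The translates of an open piece of [reached K] by elements [z] of [H] cover
    [H]; grouping them by the finite set that reaches [z] makes the cover
    directed. *)
Lemma reached_uniformly :
  H `<=` \bigcup_(K in finite_set) reached K ->
  exists2 K, finite_set K & H `<=` reached K.
Proof.
move=> Hreached.
have [K [U [finK oU [x [Ux Hx]] UK]]] := reached_nbhs Hreached.
pose W K' : set (prod_topology G) :=
  \bigcup_(z in H `&` reached K') ((fun h => z^-1 * h)%g @^-1` U).
have [K' finK' HW] : exists2 K', finite_set K' & H `<=` W K'.
  apply: compact_directed_cover.
  - by rewrite -(setIT H); exact: compactI closedT.
  - move=> K'; apply: bigcup_open => z _; apply: open_comp => // h _.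
    exact: mulgl_continuous.
  - move=> K1 K2 K12 h [z [Hz [g [Hg gK1] pg]] Uzh]; exists z => //; split=> //.
    by exists g => //; split=> //; exact: direct_sumS gK1.
  move=> h Hh; have Hz : H (h * x^-1)%g by exact: HV.
  have [K1 finK1 K1z] := Hreached _ Hz.
  by exists K1 => //; exists (h * x^-1)%g => //=; rewrite invgM invgK -mulgA mulVg mulg1.
exists (K' `|` K); first by rewrite finite_setU.
move=> h Hh; have [z [Hz [g [Hg gK'] pg]] Uzh] := HW h Hh.
have [|g' [Hg' g'K] pg'] := UK (z^-1 * h)%g.
  by split=> //; rewrite -[z^-1%g]mul1g; exact: HM (HV H1 Hz) Hh.
exists (g * g')%g; first by split; [exact: HM|exact: direct_sumM].
rewrite -[h](mulVKg z).
by apply/functional_extensionality_dep => j; congr (_ * _)%g;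
  [exact: (congr1 (fun f => f j) pg)|exact: (congr1 (fun f => f j) pg')].
Qed.

End Product.

Theorem corollary2p7 (I : Type) (G : I -> topologicalGroupType)
    (compactG : forall i : I, compact [set: G i])
    (hausdorffG : forall i : I, hausdorff_space (G i))
    (H : set (prod_topology G))
    (subgroupH : subgroup H) (closedH : closed H) :
  controllable H <-> uniformly_controllable H.
Proof.
split=> [ctrlH J finJ|uctrlH J finJ].
  have [h Hh|K finK HK] :=
    @reached_uniformly I G compactG hausdorffG H J subgroupH closedH.
    have : (restr J @` H) (restr J h) by exists h.
    rewrite ctrlH // => -[g [Hg [fg _]] pg].
    exists [set i | g i <> 1%g] => //; exists g => //; split=> //; split=> // i.
    exact: contrapT.
  exists K => //; apply/seteqP; split=> [_ [h Hh <-]|_ [g [Hg _] <-]].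
    exact: HK.
  by exists g.
have [K finK HK] := uctrlH J finJ; rewrite HK.
apply/seteqP; split=> _ [g [Hg gK] <-].
  by exists g => //; split=> //; apply: direct_sumS gK.
by rewrite -HK; exists g.
Qed.
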